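(* Let $A\in\mathbb{R}^{n\times n}$ be Hurwitz, $B\in\mathbb{R}^{n\times m}$, $C\in\mathbb{R}^{m\times n}$, $D\in\mathbb{R}^{m\times m}$ with $\|D\|<1$, and let $\Sigma$ be the system $\dot{\mathbf{x}}(t)=A\mathbf{x}(t)+B\,\Phi\circ(I-D\Phi)^{-1}(C\mathbf{x}(t))$. Primal LMI: find a positive definite $P\in\mathbb{S}^n$ and $\Pi\in\boldsymbol{\Pi}_{\mathcal{NN}}$ such that $$\begin{bmatrix} PA+A^TP & PB\\ B^TP & 0\end{bmatrix}+\begin{bmatrix} C & D\\ 0 & I_m\end{bmatrix}^T\Pi\begin{bmatrix} C & D\\ 0 & I_m\end{bmatrix}\prec 0.$$ Dual LMI: find a nonzero positive semidefinite $H=\begin{bmatrix}H_{11}&H_{12}\\H_{12}^T&H_{22}\end{bmatrix}\in\mathbb{S}^{n+m}$ (with $H_{11}\in\mathbb{S}^n$, $H_{22}\in\mathbb{S}^m$) such that $$AH_{11}+BH_{12}^T+(AH_{11}+BH_{12}^T)^T\succeq 0,$$ $$\begin{bmatrix}-C & I_m-D\\ 0 & I_m\end{bmatrix}H\begin{bmatrix}-C & I_m-D\\ 0 & I_m\end{bmatrix}^T\ \text{is entrywise nonnegative},$$ $$\mathrm{diag}\big(-CH_{12}+(I_m-D)H_{22}\big)=0.$$ Then $\Sigma$ is globally asymptotically stable if the primal LMI is feasible. Moreover, the primal LMI is infeasible if and only if the dual LMI is feasible.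
   Context: $\|D\|$ is the spectral norm; $\Phi$ is the componentwise ReLU $\Phi(q)_i=\max(q_i,0)$; $(I-D\Phi)^{-1}$ is the inverse of the bijection $q\mapsto q-D\Phi(q)$ of $\mathbb{R}^m$ (well defined when $\|D\|<1$). Global asymptotic stability of the origin means: for each $\varepsilon>0$ there is $\delta>0$ with $\|\mathbf{x}(0)\|<\delta\Rightarrow\|\mathbf{x}(t)\|<\varepsilon$ for all $t\ge 0$, and $\lim_{t\to\infty}\mathbf{x}(t)=0$ for every initial state. $\mathbb{S}^k$ is the set of real symmetric $k\times k$ matrices; $\mathrm{diag}(M)$ is the vector of diagonal entries of a square matrix $M$. $\mathcal{NN}^{2m}$ is the set of symmetric $2m\times 2m$ matrices with all entries nonnegative. $\boldsymbol{\Pi}_{\mathcal{NN}}:=\{E^T(Q+\mathcal{J}(J))E:\ J\in\mathbb{R}^{m\times m}\text{ diagonal},\ Q\in\mathcal{NN}^{2m}\}$, where $E=\begin{bmatrix}-I_m & I_m\\ 0 & I_m\end{bmatrix}$ and $\mathcal{J}(J)=\begin{bmatrix}0 & J\\ J & 0\end{bmatrix}$. *)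

(* Defs.v *)
From HB Require Import structures.
From mathcomp Require Import all_boot all_order all_algebra.
From mathcomp Require Import all_classical all_reals topology normedtype derive.
From mathcomp Require Import complex.
Set Implicit Arguments. Unset Strict Implicit. Unset Printing Implicit Defensive.
Import Order.TTheory GRing.Theory Num.Theory.
Import numFieldNormedType.Exports.
Local Open Scope classical_set_scope.
Local Open Scope ring_scope.

Section Defs.
Variable R : realType.

Definition enorm (k : nat) (v : 'cV[R]_k) : R := Num.sqrt (\sum_i (v i 0) ^+ 2).

Definition specnorm (p q : nat) (M : 'M[R]_(p, q)) : R :=
  sup [set enorm (M *m v) | v in [set v : 'cV[R]_q | enorm v <= 1]].

Definition hurwitz (k : nat) (A : 'M[R]_k) : Prop :=
  forall z : R[i], root (map_poly (real_complex R) (char_poly A)) z ->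
    complex.Re z < 0.

Definition symmetric (k : nat) (M : 'M[R]_k) : Prop := M^T = M.

Definition posdef (k : nat) (M : 'M[R]_k) : Prop :=
  symmetric M /\ forall x : 'cV[R]_k, x != 0 -> 0 < (x^T *m M *m x) 0 0.

Definition possemidef (k : nat) (M : 'M[R]_k) : Prop :=
  symmetric M /\ forall x : 'cV[R]_k, 0 <= (x^T *m M *m x) 0 0.

Definition negdef (k : nat) (M : 'M[R]_k) : Prop := posdef (- M).

Definition relu (k : nat) (q : 'cV[R]_k) : 'cV[R]_k :=
  map_mx (fun a => Num.max a 0) q.

(* (I - D Phi)^{-1} y : the q with q - D Phi(q) = y (unique when ||D|| < 1) *)
Definition resolv (m : nat) (D : 'M[R]_m) (y : 'cV[R]_m) : 'cV[R]_m :=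
  xget 0 [set q : 'cV[R]_m | q - D *m relu q = y].

Definition sysf (n m : nat) (A : 'M[R]_n) (B : 'M[R]_(n, m)) (C : 'M[R]_(m, n))
  (D : 'M[R]_m) (x : 'cV[R]_n) : 'cV[R]_n :=
  A *m x + B *m relu (resolv D (C *m x)).

Definition is_solution (n : nat) (f : 'cV[R]_n -> 'cV[R]_n) (x : R -> 'cV[R]_n) : Prop :=
  (forall t : R, 0 < t -> is_derive t 1 x (f (x t))) /\
  x t @[t --> 0^'+] --> x 0.

Definition GAS (n : nat) (f : 'cV[R]_n -> 'cV[R]_n) : Prop :=
  (forall eps : R, 0 < eps -> exists2 delta : R, 0 < delta &
     forall x, is_solution f x -> enorm (x 0) < delta ->
       forall t : R, 0 <= t -> enorm (x t) < eps) /\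
  (forall x, is_solution f x -> enorm (x t) @[t --> +oo] --> (0 : R)).

Definition nonneg_mx (p q : nat) (M : 'M[R]_(p, q)) : Prop :=
  forall i j, 0 <= M i j.

Definition Emx (m : nat) : 'M[R]_(m + m) :=
  block_mx (- 1%:M) 1%:M 0 1%:M.

Definition Jmx (m : nat) (J : 'M[R]_m) : 'M[R]_(m + m) :=
  block_mx 0 J J 0.

Definition PiNN (m : nat) (Pi : 'M[R]_(m + m)) : Prop :=
  exists (J : 'M[R]_m) (Q : 'M[R]_(m + m)),
    is_diag_mx J /\ symmetric Q /\ nonneg_mx Q /\
    Pi = (Emx m)^T *m (Q + Jmx J) *m Emx m.

Definition primal_LMI (n m : nat) (A : 'M[R]_n) (B : 'M[R]_(n, m))
  (C : 'M[R]_(m, n)) (D : 'M[R]_m) : Prop :=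
  exists (P : 'M[R]_n) (Pi : 'M[R]_(m + m)),
    posdef P /\ PiNN Pi /\
    negdef (block_mx (P *m A + A^T *m P) (P *m B) (B^T *m P) (0 : 'M[R]_m)
            + (block_mx C D 0 (1%:M : 'M[R]_m))^T *m Pi
              *m block_mx C D 0 (1%:M : 'M[R]_m)).

Definition dual_LMI (n m : nat) (A : 'M[R]_n) (B : 'M[R]_(n, m))
  (C : 'M[R]_(m, n)) (D : 'M[R]_m) : Prop :=
  exists H : 'M[R]_(n + m),
    H != 0 /\ possemidef H /\
    (let H11 := ulsubmx H in let H12 := ursubmx H in let H22 := drsubmx H in
     possemidef (A *m H11 + B *m H12^T + (A *m H11 + B *m H12^T)^T) /\
     nonneg_mx (block_mx (- C) (1%:M - D) 0 (1%:M : 'M[R]_m) *m H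
                *m (block_mx (- C) (1%:M - D) 0 (1%:M : 'M[R]_m))^T) /\
     (forall i : 'I_m, (- C *m H12 + (1%:M - D) *m H22) i i = 0)).

End Defs.

(* Main.v *)
Require Import Defs.
From HB Require Import structures.
From mathcomp Require Import all_boot all_order all_algebra.
From mathcomp Require Import all_classical all_reals topology normedtype derive.
From mathcomp Require Import complex.
From mathcomp Require Import ring lra.
Import Order.TTheory GRing.Theory Num.Theory.
Import numFieldNormedType.Exports.
Local Open Scope ring_scope.
Local Open Scope classical_set_scope.

(** Stability: at [q = C x + D (relu q)] the vectors [relu q - q] and [relu q] are
nonnegative with zero entrywise product, so the multiplier term of the primal
LMI is nonnegative there; hence [x^T P x] decreases along trajectories at a rate
proportional to itself.

Alternatives: if the primal LMI is infeasible, then [-I] is not in the closure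
of the convex cone of all matrices [L(P, Pi) + S] with [P] and [S] positive
semidefinite and [Pi] a multiplier ([P > 0] may be weakened to [P >= 0] since
[P] can be perturbed). Projecting [-I] on that closure yields a nonzero
symmetric [H] whose trace pairing with the cone is nonnegative, and testing
the generators of the cone gives the dual LMI. Conversely, pairing a dual
solution with a primal one gives a trace that is both negative and nonnegative. *)

(** * Quadratic forms, squared Euclidean norms and rank-one matrices *)

Definition qform {R : realType} {k} (M : 'M[R]_k) (x : 'cV[R]_k) : R :=
  (x^T *m M *m x) 0 0.

Definition sqnorm {R : realType} {k} (x : 'cV[R]_k) : R := \sum_i x i 0 ^+ 2.

Lemma sqnorm_ge0 {R : realType} {k} (x : 'cV[R]_k) : 0 <= sqnorm x.
Proof. by apply: sumr_ge0 => i _; exact: sqr_ge0. Qed.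

Lemma sqr_le_sqnorm {R : realType} {k} (x : 'cV[R]_k) i :
  x i 0 ^+ 2 <= sqnorm x.
Proof.
rewrite /sqnorm (bigD1 i)//= lerDl.
by apply: sumr_ge0 => j _; exact: sqr_ge0.
Qed.

Lemma sqnorm_eq0 {R : realType} {k} (x : 'cV[R]_k) : (sqnorm x == 0) = (x == 0).
Proof.
apply/eqP/eqP => [x0|->]; last first.
  by rewrite /sqnorm big1// => i _; rewrite mxE expr0n.
apply/colP => i; rewrite mxE; apply/eqP; rewrite -sqrf_eq0 eq_le sqr_ge0 andbT.
by rewrite -x0 sqr_le_sqnorm.
Qed.

Lemma sqnorm0 {R : realType} {k} : sqnorm (0 : 'cV[R]_k) = 0.
Proof. by apply/eqP; rewrite sqnorm_eq0. Qed.

Lemma sqnorm_gt0 {R : realType} {k} (x : 'cV[R]_k) : (0 < sqnorm x) = (x != 0).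
Proof. by rewrite lt_def sqnorm_ge0 sqnorm_eq0 andbT. Qed.

Lemma sqnormZ {R : realType} {k} a (x : 'cV[R]_k) :
  sqnorm (a *: x) = a ^+ 2 * sqnorm x.
Proof. by rewrite /sqnorm mulr_sumr; apply: eq_bigr => i _; rewrite mxE exprMn. Qed.

Lemma qformE {R : realType} {k} (M : 'M[R]_k) x :
  qform M x = \sum_i \sum_j x i 0 * M i j * x j 0.
Proof.
rewrite /qform mxE exchange_big; apply: eq_bigr => i _ /=.
rewrite mxE mulr_suml; apply: eq_bigr => j _.
by rewrite mxE.
Qed.

Lemma qform1 {R : realType} {k} (x : 'cV[R]_k) : qform 1%:M x = sqnorm x.
Proof. by rewrite /qform mulmx1 mxE; apply: eq_bigr => i _; rewrite mxE. Qed.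

Lemma sqnorm_mulmx {R : realType} {p k} (M : 'M[R]_(p, k)) x :
  sqnorm (M *m x) = qform (M^T *m M) x.
Proof. by rewrite -qform1 /qform mulmx1 trmx_mul !mulmxA. Qed.

Lemma qform0 {R : realType} {k} (M : 'M[R]_k) : qform M 0 = 0.
Proof. by rewrite /qform mulmx0 mxE. Qed.

Lemma qform_mulmx {R : realType} {p k} (M : 'M[R]_p) (N : 'M[R]_(p, k)) x :
  qform (N^T *m M *m N) x = qform M (N *m x).
Proof. by rewrite /qform trmx_mul !mulmxA. Qed.

Lemma qformD {R : realType} {k} (M N : 'M[R]_k) x :
  qform (M + N) x = qform M x + qform N x.
Proof. by rewrite /qform mulmxDr mulmxDl mxE. Qed.

Lemma qformN {R : realType} {k} (M : 'M[R]_k) x : qform (- M) x = - qform M x.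
Proof. by rewrite /qform mulmxN mulNmx mxE. Qed.

Lemma qformB {R : realType} {k} (M N : 'M[R]_k) x :
  qform (M - N) x = qform M x - qform N x.
Proof. by rewrite qformD qformN. Qed.

Lemma qformZ {R : realType} {k} a (M : 'M[R]_k) x :
  qform (a *: M) x = a * qform M x.
Proof. by rewrite /qform -scalemxAr -scalemxAl mxE. Qed.

Lemma qform_scale {R : realType} {k} (M : 'M[R]_k) a x :
  qform M (a *: x) = a ^+ 2 * qform M x.
Proof.
by rewrite /qform [(a *: x)^T]linearZ/= -!scalemxAl -scalemxAr scalerA mxE -expr2.
Qed.

Lemma qform_trace {R : realType} {k} (M : 'M[R]_k) x :
  qform M x = \tr (M *m (x *m x^T)).
Proof. by rewrite /qform -trace_mx11 -mulmxA mxtrace_mulC mulmxA. Qed.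

Lemma qform_outer {R : realType} {k} (v x : 'cV[R]_k) :
  qform (v *m v^T) x = ((v^T *m x) 0 0) ^+ 2.
Proof.
have e : x^T *m v = (v^T *m x)^T by rewrite trmx_mul trmxK.
by rewrite /qform mulmxA -mulmxA mxE big_ord1 e [X in X * _]mxE expr2.
Qed.

Lemma outer_possemidef {R : realType} {k} (v : 'cV[R]_k) :
  possemidef (v *m v^T).
Proof.
split; first by rewrite /Defs.symmetric trmx_mul trmxK.
by move=> x; rewrite -/(qform _ x) qform_outer sqr_ge0.
Qed.

(** Each product of two coordinates is at most half the sum of their squares; summing over all pairs
    gives the factor [k]. This turns entrywise closeness of matrices into closeness of forms. *)
Lemma norm_qform_le {R : realType} {k} (M : 'M[R]_k) e x :
  (forall i j, `|M i j| <= e) -> `|qform M x| <= e * k%:R * sqnorm x.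
Proof.
move=> Me; rewrite qformE.
have h i j : `|x i 0 * M i j * x j 0| <= e / 2 * (x i 0 ^+ 2 + x j 0 ^+ 2).
  have -> : `|x i 0 * M i j * x j 0| = `|M i j| * (`|x i 0| * `|x j 0|).
    by rewrite !normrM; ring.
  have -> : e / 2 * (x i 0 ^+ 2 + x j 0 ^+ 2) =
    e * ((x i 0 ^+ 2 + x j 0 ^+ 2) / 2) by field.
  rewrite ler_pM ?mulr_ge0//.
  have := sqr_ge0 (`|x i 0| - `|x j 0|).
  rewrite -(real_normK (num_real (x i 0))) -(real_normK (num_real (x j 0))).
  by rewrite sqrrB; lra.
apply: (le_trans (ler_norm_sum _ _ _)).
apply: (@le_trans _ _ (\sum_i \sum_j e / 2 * (x i 0 ^+ 2 + x j 0 ^+ 2))).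
  apply: ler_sum => i _; apply: (le_trans (ler_norm_sum _ _ _)).
  by apply: ler_sum => j _.
rewrite le_eqVlt; apply/orP; left; apply/eqP.
under eq_bigr do rewrite -mulr_sumr big_split/= sumr_const card_ord.
rewrite -mulr_sumr big_split/= sumr_const card_ord sumrMnl -/(sqnorm x).
by rewrite -[_ *+ k]mulr_natl; field.
Qed.

Lemma qform_bounded {R : realType} {k} (M : 'M[R]_k) :
  exists2 c, 0 < c & forall x, `|qform M x| <= c * sqnorm x.
Proof.
exists ((\sum_i \sum_j `|M i j|) * k%:R + 1).
  by rewrite ltr_wpDl// mulr_ge0//; do 2!apply: sumr_ge0 => ? _.
move=> x; apply: (le_trans (norm_qform_le _ (\sum_i \sum_j `|M i j|) _ _)); last first.
  by rewrite mulrDl lerDl mul1r sqnorm_ge0.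
move=> i j; rewrite (bigD1 i)//= (bigD1 j)//= -addrA lerDl addr_ge0//.
  exact: sumr_ge0.
by do 2!apply: sumr_ge0 => ? _.
Qed.

Lemma qform_delta {R : realType} {k} (M : 'M[R]_k) i :
  qform M (delta_mx i 0) = M i i.
Proof. by rewrite /qform trmx_delta -rowE -colE !mxE. Qed.

Lemma qformDr {R : realType} {k} (M : 'M[R]_k) x y : Defs.symmetric M ->
  qform M (x + y) = qform M x + 2 * (y^T *m M *m x) 0 0 + qform M y.
Proof.
move=> sM; have e : (x^T *m M *m y) 0 0 = (y^T *m M *m x) 0 0.
  suff -> : x^T *m M *m y = (y^T *m M *m x)^T by rewrite mxE.
  by rewrite !trmx_mul trmxK mulmxA sM.
have -> : qform M (x + y) = ((x^T *m M *m x) + (x^T *m M *m y)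
    + ((y^T *m M *m x) + (y^T *m M *m y))) 0 0.
  by rewrite /qform [(x + y)^T]linearD/= !mulmxDl !mulmxDr.
by rewrite [LHS]mxE [X in X + _]mxE [X in _ + X]mxE e /qform; ring.
Qed.

Lemma delta_mulmx {R : realType} {k} (M : 'M[R]_k) i (x : 'cV[R]_k) :
  (((delta_mx i 0 : 'cV_k)^T) *m M *m x) 0 0 = (row i M *m x) 0 0.
Proof. by rewrite trmx_delta -rowE. Qed.

(** * Positive semidefinite matrices: rank-one decomposition and trace pairing *)

Lemma possemidef_diag_ge0 {R : realType} {k} (H : 'M[R]_k) i :
  possemidef H -> 0 <= H i i.
Proof. by move=> [_ /(_ (delta_mx i 0))]; rewrite -/(qform _ _) qform_delta. Qed.

(** With zero diagonal the form at [delta_mx j 0 + a *: delta_mx i 0] is linear in [a], so both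
    signs of [a] together force the entry to vanish. *)
Lemma possemidef_diag0 {R : realType} {k} (H : 'M[R]_k) :
  possemidef H -> (forall i, H i i = 0) -> H = 0.
Proof.
move=> [sH pH] H0; apply/matrixP => i j; rewrite mxE.
have h a : 0 <= 2 * (a * H i j).
  have := pH (delta_mx j 0 + a *: delta_mx i 0); rewrite -/(qform _ _) qformDr//.
  rewrite qform_scale !qform_delta !H0 mulr0 addr0 add0r.
  by rewrite [(_ *: _)^T]linearZ/= -!scalemxAl mxE delta_mulmx -colE !mxE.
have := h 1; have := h (- 1); lra.
Qed.

(* Symmetric elimination of the diagonal entry [H i i]; positivity is the
   Cauchy-Schwarz inequality for the form [H]. *)
Lemma possemidef_elim {R : realType} {k} (H : 'M[R]_k) i :
  possemidef H -> 0 < H i i ->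
  possemidef (H - (H i i)^-1 *: (col i H *m (col i H)^T)).
Proof.
move=> [sH pH] a0; split.
  by rewrite /Defs.symmetric linearB/= linearZ/= trmx_mul trmxK sH.
move=> x; rewrite -/(qform _ x) qformB qformZ qform_outer.
have -> : (col i H)^T = row i H by rewrite tr_col sH.
set s := (row i H *m x) 0 0.
(* This shift along the [i]-th basis vector minimises the form in that direction: it completes the
   square. *)
have := pH (x + (- s / H i i) *: delta_mx i 0); rewrite -/(qform _ _) qformDr//.
rewrite qform_scale qform_delta [(_ *: _)^T]linearZ/= -!scalemxAl mxE delta_mulmx -/s.
have -> : qform H x + 2 * (- s / H i i * s) + (- s / H i i) ^+ 2 * H i i =
  qform H x - (H i i)^-1 * s ^+ 2 by field; rewrite gt_eqF.
by [].
Qed.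

(** Induction on the number of nonzero diagonal entries: eliminating a pivot splits off one rank-one
    term, as in a Cholesky factorisation. *)
Lemma possemidef_sum_outer {R : realType} {k} (H : 'M[R]_k) :
  possemidef H -> exists s : seq 'cV[R]_k, H = \sum_(v <- s) v *m v^T.
Proof.
have [r] := ubnP #|[pred i | H i i != 0]|; elim: r H => // r IH H Hr pH.
have [/existsP[i Hi]|/existsPn H0] := boolP [exists i, H i i != 0]; last first.
  exists [::]; rewrite big_nil; apply: possemidef_diag0 => // i.
  by apply/eqP; rewrite -[_ == _]negbK H0.
have a0 : 0 < H i i by rewrite lt_def Hi possemidef_diag_ge0.
have pH' := possemidef_elim H i pH a0; set H' := _ - _ in pH'.
have H'E j : H' j j = H j j - (H i i)^-1 * H j i ^+ 2.
  by rewrite !mxE big_ord1 !mxE expr2.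
have [|//|s Hs] := IH H'.
  rewrite -ltnS (leq_trans _ Hr)// ltnS; apply/proper_card/properP; split.
    (* A zero diagonal entry stays zero: its new value is minus a nonnegative number, yet [H'] is
       positive semidefinite. *)
    apply/fintype.subsetP => j; rewrite !inE; apply: contra => /eqP Hj.
    rewrite eq_le (possemidef_diag_ge0 H' j)// andbT H'E Hj sub0r oppr_le0.
    by rewrite mulr_ge0 ?sqr_ge0// invr_ge0 ltW.
  exists i; rewrite !inE// H'E negbK subr_eq0 expr2 mulrA mulVf//.
  by rewrite mul1r.
exists (Num.sqrt (H i i)^-1 *: col i H :: s); rewrite big_cons -Hs.
rewrite [(_ *: _)^T]linearZ/= -scalemxAl -scalemxAr scalerA -expr2 sqr_sqrtr ?invr_ge0 ?ltW//.
by rewrite addrC subrK.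
Qed.

Lemma mxtrace_sum_outer {R : realType} {k} (s : seq 'cV[R]_k) (M : 'M[R]_k) :
  \tr (M *m \sum_(v <- s) v *m v^T) = \sum_(v <- s) qform M v.
Proof.
rewrite mulmx_sumr raddf_sum; apply: eq_bigr => v _.
by rewrite qform_trace.
Qed.

Lemma mxtrace_possemidef_ge0 {R : realType} {k} (M H : 'M[R]_k) :
  possemidef M -> possemidef H -> 0 <= \tr (M *m H).
Proof.
move=> [_ pM] /possemidef_sum_outer[s ->]; rewrite mxtrace_sum_outer.
by apply: sumr_ge0 => v _; exact: pM.
Qed.

(** A nonzero sum of outer products has a nonzero vector, whose term is strictly positive; the other
    terms are nonnegative. *)
Lemma mxtrace_posdef_gt0 {R : realType} {k} (M H : 'M[R]_k) :
  posdef M -> possemidef H -> H != 0 -> 0 < \tr (M *m H).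
Proof.
move=> [_ pM] /possemidef_sum_outer[s ->]; rewrite mxtrace_sum_outer.
have M0 v : 0 <= qform M v.
  have [->|/pM/ltW//] := eqVneq v 0; first by rewrite qform0.
elim: s => [|v s IH]; first by rewrite big_nil eqxx.
rewrite !big_cons; have [->|/pM v0 _] := eqVneq v 0; last first.
  by rewrite ltr_pwDl// sumr_ge0.
by rewrite mul0mx add0r => /IH h; rewrite ltr_wpDl.
Qed.

(** * Continuity, compactness and existence of minimisers for matrices *)

Lemma cvg_sum_ord {R : realType} {T : Type} {F : set_system T} {FF : Filter F}
    {k} (f : 'I_k -> T -> R) (l : 'I_k -> R) :
  (forall i, f i t @[t --> F] --> l i) ->
  (\sum_i f i t) @[t --> F] --> \sum_i l i.
Proof. by move=> fl; apply: cvg_big => // x; exact: add_continuous. Qed.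

Lemma continuous_sum_ord {R : realType} {T : topologicalType} {k}
    (f : 'I_k -> T -> R) :
  (forall i, continuous (f i)) -> continuous (fun t => \sum_i f i t).
Proof. by move=> cf t; apply: cvg_sum_ord => i; exact: cf. Qed.

Lemma continuous_mulr {R : realType} {T : topologicalType} (f g : T -> R) :
  continuous f -> continuous g -> continuous (fun t => f t * g t).
Proof. by move=> cf cg t; exact: cvgM (cf t) (cg t). Qed.

Lemma continuous_subr {R : realType} {T : topologicalType} (f g : T -> R) :
  continuous f -> continuous g -> continuous (fun t => f t - g t).
Proof. by move=> cf cg t; exact: cvgB (cf t) (cg t). Qed.

Lemma continuous_cstr {R : realType} {T : topologicalType} (a : R) :
  continuous (fun _ : T => a).
Proof. by move=> t; exact: cvg_cst. Qed.

Lemma continuous_mx {R : realType} {T : topologicalType} {p q}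
    (f : T -> 'M[R]_(p, q)) :
  (forall i j, continuous (fun t => f t i j)) -> continuous f.
Proof.
move=> cf t A [P MP sPA].
suff : nbhs t (fun s => forall i j, P i j (f s i j)).
  by apply: filterS => s; exact: sPA.
by apply: filter_forall => i; apply: filter_forall => j; exact: cf.
Qed.

(** The box is the continuous image under [vec_mx] of a product of segments. *)
Lemma box_compact {R : realType} {p q} (b : R) :
  compact [set X : 'M[R]_(p, q) | forall i j, `|X i j| <= b].
Proof.
have -> : [set X : 'M[R]_(p, q) | forall i j, `|X i j| <= b] =
    [set vec_mx v | v in
      [set v : 'rV[R]_(p * q) | forall i, `[(- b), b] (v ord0 i)]].
  apply/seteqP; split=> [X Xb|_ [v vb <-] i j].
    exists (mxvec X); last exact: mxvecK.
    by move=> i; case/mxvec_indexP: i => i j; rewrite mxvecE /= in_itv/= -ler_norml.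
  by rewrite mxE ler_norml; have := vb (mxvec_index i j); rewrite /= in_itv.
apply: continuous_compact; last first.
  by apply: (@rV_compact _ _ (fun=> `[(- b), b])) => _; exact: segment_compact.
apply: continuous_subspaceT; apply: continuous_mx => i j v.
under eq_fun do rewrite mxE.
exact: coord_continuous.
Qed.

(** Points of [S] not exceeding the value at [X0] lie in a compact box, where a minimum is attained;
    all other points have larger values. It serves to project on a closed cone, to bound a form on
    the sphere and to solve the resolvent equation. *)
Lemma coercive_min {R : realType} {p q} (S : set 'M[R]_(p, q))
    (f : 'M[R]_(p, q) -> R) (X0 : 'M[R]_(p, q)) (b : R) :
  closed S -> S X0 -> continuous f ->
  (forall X, S X -> f X <= f X0 -> forall i j, `|X i j| <= b) ->
  exists2 Z, S Z & forall X, S X -> f Z <= f X.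
Proof.
move=> cS SX0 cf fb.
have [|Z + Zmin] := @compact_EVT_min _ _ f _ _
    (compact_closedI (box_compact b) cS) (continuous_subspaceT cf).
  by exists X0; split=> //; apply: fb.
rewrite inE => -[_ SZ]; exists Z => // X SX.
have [/(fb _ SX) Xb|/ltW X0X] := leP (f X) (f X0); first by apply: Zmin; rewrite inE.
apply: le_trans X0X; apply: Zmin; rewrite inE; split=> //; exact: fb.
Qed.

(** * Entrywise inner product, separation from a convex cone, coercivity *)

Definition mxdot {R : realType} {p q} (X Y : 'M[R]_(p, q)) : R :=
  \sum_i \sum_j X i j * Y i j.

Lemma mxdot_ge0 {R : realType} {p q} (X : 'M[R]_(p, q)) : 0 <= mxdot X X.
Proof. by do 2!apply: sumr_ge0 => ? _; rewrite -expr2 sqr_ge0. Qed.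

Lemma sqr_le_mxdot {R : realType} {p q} (X : 'M[R]_(p, q)) i j :
  X i j ^+ 2 <= mxdot X X.
Proof.
rewrite /mxdot (bigD1 i)//= (bigD1 j)//= -addrA expr2 lerDl addr_ge0//.
  by apply: sumr_ge0 => ? _; rewrite -expr2 sqr_ge0.
by do 2!apply: sumr_ge0 => ? _; rewrite -expr2 sqr_ge0.
Qed.

Lemma mxdot_addZ {R : realType} {p q} (X Y : 'M[R]_(p, q)) t :
  mxdot (X + t *: Y) (X + t *: Y) =
  mxdot X X + 2 * t * mxdot X Y + t ^+ 2 * mxdot Y Y.
Proof.
rewrite /mxdot !mulr_sumr -!big_split; apply: eq_bigr => i _ /=.
rewrite !mulr_sumr -!big_split; apply: eq_bigr => j _ /=.
by rewrite !mxE; ring.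
Qed.

Lemma mxdot_continuous {R : realType} {p q} (E : 'M[R]_(p, q)) :
  continuous (fun X : 'M[R]_(p, q) => mxdot (X - E) (X - E)).
Proof.
have h i j : continuous (fun Y : 'M[R]_(p, q) => (Y - E) i j).
  have -> : (fun Y : 'M[R]_(p, q) => (Y - E) i j) = (fun Y => Y i j - E i j).
    by apply/funext => Y; rewrite !mxE.
  by apply: continuous_subr; [exact: coord_continuous|exact: continuous_cstr].
apply: continuous_sum_ord => i; apply: continuous_sum_ord => j.
by apply: continuous_mulr; exact: h.
Qed.

(* [H] is the difference between [E] and its projection [E + H] on
   [closure K]. *)
Lemma cone_separation {R : realType} {p q} (K : set 'M[R]_(p, q))
    (E : 'M[R]_(p, q)) :
  K 0 -> (forall X Y, K X -> K Y -> K (X + Y)) ->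
  (forall t X, 0 <= t -> K X -> K (t *: X)) -> ~ closure K E ->
  exists H, [/\ H != 0, closure K (E + H) & forall X, K X -> 0 <= mxdot H X].
Proof.
move=> K0 KD KZ KE.
have [|||Z KZ' Zmin] := coercive_min (closure K)
    (fun X => mxdot (X - E) (X - E)) 0
    (mxdot E E + 1 + \sum_i \sum_j `|E i j|) (@closed_closure _ K).
- exact: subset_closure.
- exact: mxdot_continuous.
- move=> X _; rewrite sub0r => h i j.
  have Eij : `|E i j| <= \sum_i \sum_j `|E i j|.
    rewrite (bigD1 i)//= (bigD1 j)//= -addrA lerDl addr_ge0 ?sumr_ge0//.
    by move=> ? _; exact: sumr_ge0.
  have e : mxdot (- E) (- E) = mxdot E E.
    by do 2!apply: eq_bigr => ? _; rewrite !mxE mulrNN.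
  have := le_trans (sqr_le_mxdot (X - E) i j) h; rewrite e !mxE => h1.
  (* From [r ^+ 2 <= s] follows [|r| <= s + 1], by expanding the squares of [r - 1] and [r + 1]. *)
  have h2 : `|X i j - E i j| <= mxdot E E + 1.
    rewrite ler_norml; have := sqr_ge0 (X i j - E i j - 1).
    have := sqr_ge0 (X i j - E i j + 1); have := sqr_ge0 (X i j - E i j).
    by move: h1; rewrite !expr2 => *; apply/andP; split; lra.
  rewrite -(subrK (E i j) (X i j)); apply: (le_trans (ler_normD _ _)).
  exact: lerD.
exists (Z - E); split.
- by rewrite subr_eq0; apply/eqP => ZE; apply: KE; rewrite -ZE.
- by rewrite addrC subrK.
move=> X KX; set a := mxdot _ _; set b := mxdot X X.
have b0 : 0 <= b by exact: mxdot_ge0.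
(* [Z] is optimal along the ray [Z + t *: X]; the increase of the squared distance divided by [t]
   gives this bound. *)
have h t : 0 < t -> 0 <= 2 * a + t * b.
  move=> t0.
  (* Translation by [t *: X] is continuous and maps the cone into itself, hence also its closure. *)
  have /Zmin : closure K (Z + t *: X).
    move=> A /= AZ.
    have [Y [KY AY]] : K `&` (fun Y => A (Y + t *: X)) !=set0.
      apply: KZ'.
      have c : continuous (fun Y : 'M[R]_(p, q) => Y + t *: X).
        apply: continuous_mx => i j.
        have -> : (fun Y : 'M[R]_(p, q) => (Y + t *: X) i j) =
            (fun Y => Y i j - - (t *: X) i j).
          by apply/funext => Y; rewrite mxE opprK.
        apply: continuous_subr; first exact: coord_continuous.
        exact: continuous_cstr.
      exact: c.
    exists (Y + t *: X); split=> //; apply: KD => //; apply: KZ => //.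
    exact: ltW.
  rewrite addrAC mxdot_addZ -/a -/b -addrA lerDl.
  have -> : 2 * t * a + t ^+ 2 * b = t * (2 * a + t * b) by ring.
  by rewrite pmulr_rge0.
rewrite leNgt; apply/negP => a0.
have b1 : 0 < b + 1 by lra.
(* If [a < 0], this [t] gives [t * b <= - a], so [2 * a + t * b <= a < 0]. The shift [b + 1] covers
   [b = 0]. *)
have := h (- a / (b + 1)); rewrite divr_gt0 ?oppr_gt0// => /(_ isT).
have : - a / (b + 1) * b <= - a.
  by rewrite mulrAC ler_pdivrMr// ler_wpM2l//; lra.
lra.
Qed.

(** The constant is the minimum of the form on the unit sphere; homogeneity extends the bound to all
    vectors. *)
Lemma posdef_coercive {R : realType} {k} (M : 'M[R]_k) : posdef M ->
  exists2 c, 0 < c & forall x, c * sqnorm x <= qform M x.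
Proof.
move=> [_ pM].
have csq : continuous (@sqnorm R k).
  apply: continuous_sum_ord => i.
  by apply: continuous_mulr; exact: coord_continuous.
have cq : continuous (qform M).
  rewrite (funext (qformE M)); apply: continuous_sum_ord => i.
  apply: continuous_sum_ord => j.
  apply: continuous_mulr; last exact: coord_continuous.
  by apply: continuous_mulr; [exact: coord_continuous|exact: continuous_cstr].
(* In dimension zero the sphere is empty and any positive constant serves. *)
have [[v v0]|nv] := pselect (exists v : 'cV[R]_k, v != 0); last first.
  exists 1 => // x; have [->|x0] := eqVneq x 0; last by case: nv; exists x.
  by rewrite qform0 sqnorm0 mulr0.
have normalize (x : 'cV[R]_k) : x != 0 ->
    sqnorm ((Num.sqrt (sqnorm x))^-1 *: x) = 1.
  move=> x0; rewrite sqnormZ exprVn sqr_sqrtr ?sqnorm_ge0// mulVf//.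
  by rewrite sqnorm_eq0.
have [||||u /= u1 umin] := coercive_min [set x : 'cV[R]_k | sqnorm x = 1]
    (qform M) ((Num.sqrt (sqnorm v))^-1 *: v) 1.
- exact: (continuous_closedP _).1 csq _ (@closed_eq _ 1).
- exact: normalize.
- exact: cq.
- move=> x /= x1 _ i j; rewrite (ord1 j) -ler_sqr ?nnegrE// real_normK ?num_real//.
  by rewrite expr1n -x1 sqr_le_sqnorm.
exists (qform M u); first by apply: pM; rewrite -sqnorm_eq0 u1 oner_eq0.
move=> x; have [->|x0] := eqVneq x 0.
  by rewrite qform0 sqnorm0 mulr0.
have := umin _ (normalize x x0); rewrite qform_scale exprVn sqr_sqrtr ?sqnorm_ge0//.
by rewrite ler_pdivlMl ?sqnorm_gt0// mulrC.
Qed.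

(** * Euclidean norm, spectral norm and the resolvent equation *)

Lemma sqr_enorm {R : realType} {k} (x : 'cV[R]_k) : enorm x ^+ 2 = sqnorm x.
Proof. by rewrite /enorm sqr_sqrtr// sqnorm_ge0. Qed.

Lemma enorm_ge0 {R : realType} {k} (x : 'cV[R]_k) : 0 <= enorm x.
Proof. exact: sqrtr_ge0. Qed.

Lemma enorm_lt {R : realType} {k} (x : 'cV[R]_k) e : 0 < e ->
  (enorm x < e) = (sqnorm x < e ^+ 2).
Proof. by move=> e0; rewrite -sqr_enorm ltr_sqr ?nnegrE ?enorm_ge0 ?ltW. Qed.

(** [rho] is the square of the spectral norm. A supremum is known to dominate its set once the set
    is bounded, so boundedness comes first; normalising [x] then gives the estimate. *)
Lemma specnorm_lt1 {R : realType} {p k} (M : 'M[R]_(p, k)) : specnorm M < 1 ->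
  exists rho, [/\ 0 <= rho, rho < 1 & forall x, sqnorm (M *m x) <= rho * sqnorm x].
Proof.
move=> M1; set S := [set enorm (M *m v) | v in [set v | enorm v <= 1]].
have ubS : has_ubound S.
  have [c c0 qc] := qform_bounded (M^T *m M); exists (c + 1) => _ [v /= v1 <-].
  have c1 : 0 <= c + 1 by rewrite addr_ge0// ltW.
  rewrite -ler_sqr ?nnegrE ?enorm_ge0// sqr_enorm sqnorm_mulmx.
  apply: (le_trans (ler_norm _)); apply: (le_trans (qc v)).
  have v2 : sqnorm v <= 1.
    by rewrite -sqr_enorm -(expr1n _ 2) ler_sqr ?nnegrE ?enorm_ge0.
  by have := ler_wpM2l (ltW c0) v2; rewrite expr2; nra.
have S0 : 0 <= specnorm M.
  apply: ub_le_sup => //; exists 0.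
    by rewrite /= -ler_sqr ?nnegrE ?enorm_ge0// sqr_enorm sqnorm0 expr1n.
  by apply/eqP; rewrite -sqrf_eq0 sqr_enorm mulmx0 sqnorm0.
exists (specnorm M ^+ 2); split; [exact: sqr_ge0|by rewrite expr_lt1|move=> x].
have [->|x0] := eqVneq x 0; first by rewrite mulmx0 !sqnorm0 mulr0.
have n0 : 0 < enorm x by rewrite -sqrtr0 ltr_sqrt ?sqnorm_gt0.
have h : enorm (M *m ((enorm x)^-1 *: x)) <= specnorm M.
  apply: ub_le_sup => //; exists ((enorm x)^-1 *: x) => //=.
  rewrite -ler_sqr ?nnegrE ?enorm_ge0// sqr_enorm sqnormZ -sqr_enorm -exprMn.
  by rewrite mulVf ?gt_eqF// lexx.
move: h; rewrite -ler_sqr ?nnegrE ?enorm_ge0// sqr_enorm -scalemxAr sqnormZ.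
by rewrite exprVn ler_pdivrMl ?exprn_gt0// sqr_enorm mulrC.
Qed.

Lemma relu_lipschitz {R : realType} {k} (x y : 'cV[R]_k) :
  sqnorm (relu x - relu y) <= sqnorm (x - y).
Proof.
apply: ler_sum => i _; rewrite !mxE.
have := sqr_ge0 (x i 0 - y i 0); have := sqr_ge0 (x i 0).
have := sqr_ge0 (y i 0); rewrite !expr2.
case: (leP (x i 0) 0) => x0; case: (leP (y i 0) 0) => y0; try lra.
- by have := mulr_le0_ge0 x0 (ltW y0); lra.
- by have := mulr_ge0_le0 (ltW x0) y0; lra.
Qed.

Lemma relu0 {R : realType} {k} : relu (0 : 'cV[R]_k) = 0.
Proof. by apply/colP => i; rewrite !mxE maxxx. Qed.

(** Young's inequality: the defect in each coordinate is a square divided by [s]. A small [s] keeps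
    the factor on [x] close to 1. *)
Lemma sqnormD_le {R : realType} {k} (s : R) (x y : 'cV[R]_k) : 0 < s ->
  sqnorm (x + y) <= (1 + s) * sqnorm x + (1 + s^-1) * sqnorm y.
Proof.
move=> s0; rewrite /sqnorm !mulr_sumr -big_split; apply: ler_sum => i _ /=.
rewrite mxE -subr_ge0.
have -> : (1 + s) * x i 0 ^+ 2 + (1 + s^-1) * y i 0 ^+ 2 -
  (x i 0 + y i 0) ^+ 2 = s^-1 * (s * x i 0 - y i 0) ^+ 2.
  by field; rewrite gt_eqF.
by rewrite mulr_ge0 ?sqr_ge0// invr_ge0 ltW.
Qed.

(* A minimiser [q] of the residual [y + D relu q - q] has residual zero:
   replacing [q] by [y + D relu q] multiplies the residual by at most
   [|D| < 1]. *)
Lemma resolvP {R : realType} {m} (D : 'M[R]_m) (y : 'cV[R]_m) :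
  specnorm D < 1 -> resolv D y - D *m relu (resolv D y) = y.
Proof.
move=> /specnorm_lt1[rho [rho0 rho1 Drho]].
(* [xget] returns a member of the set as soon as one exists, so it suffices to produce a
   solution. *)
apply: (@xgetPex _ 0 [set q : 'cV[R]_m | q - D *m relu q = y]).
pose res q := y + D *m relu q - q.
have Drelu q q' : sqnorm (D *m relu q - D *m relu q') <= rho * sqnorm (q - q').
  rewrite -mulmxBr; apply: (le_trans (Drho _)).
  by rewrite ler_wpM2l// relu_lipschitz.
(* With this [s], [1 - (1 + s) * rho] equals [(1 - rho) * (1 - rho / 2)], which is positive. *)
pose s := (1 - rho) / 2.
have s0 : 0 < s by rewrite /s; lra.
have c0 : 0 < 1 - (1 + s) * rho by rewrite /s; nra.
pose b := (1 + s^-1) * (4 * sqnorm y) / (1 - (1 + s) * rho).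
have [||||q _ qmin] := coercive_min setT (fun q => sqnorm (res q)) 0 (b + 1).
- exact: closedT.
- by [].
- have cr i : continuous (fun q : 'cV[R]_m => relu q i 0).
    move=> q; rewrite (_ : (fun q : 'cV[R]_m => relu q i 0) =
      (fun q => q i 0) \max (fun _ => 0)); last first.
      by apply/funext => z; rewrite mxE.
    by apply: continuous_max; [exact: coord_continuous|exact: continuous_cstr].
  have h i : continuous (fun q : 'cV[R]_m => res q i 0).
    rewrite (_ : (fun q : 'cV[R]_m => res q i 0) =
      (fun q => \sum_j D i j * relu q j 0 - (q i 0 - y i 0))); last first.
      by apply/funext => z; rewrite !mxE; ring.
    apply: continuous_subr.
      apply: continuous_sum_ord => j; apply: continuous_mulr => //.
      exact: continuous_cstr.
    by apply: continuous_subr; [exact: coord_continuous|exact: continuous_cstr].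
  by apply: continuous_sum_ord => i; apply: continuous_mulr; exact: h.
- move=> q _; rewrite /res relu0 mulmx0 addr0 subr0 => hq i j; rewrite (ord1 j).
  have h1 : sqnorm (y - (y + D *m relu q - q)) <= 4 * sqnorm y.
    apply: (le_trans (sqnormD_le 1 _ _ _)) => //.
    by rewrite -scaleN1r sqnormZ invr1; lra.
  (* [q] is split into [D *m relu q] and [y] minus the residual; as [(1 + s) * rho < 1], the term in
     [sqnorm q] is absorbed on the left, which yields [b]. *)
  have h2 : sqnorm q <= (1 + s) * (rho * sqnorm q) + (1 + s^-1) * (4 * sqnorm y).
    have {1}-> : q = D *m relu q + (y - (y + D *m relu q - q)).
      by apply/colP => l; rewrite !mxE; ring.
    apply: (le_trans (sqnormD_le s _ _ s0)); apply: lerD.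
      rewrite ler_wpM2l ?addr_ge0 ?(ltW s0)//.
      by have := Drelu q 0; rewrite relu0 mulmx0 !subr0.
    by rewrite ler_wpM2l// addr_ge0// invr_ge0 ltW.
  have h3 : sqnorm q <= b by rewrite ler_pdivlMr//; lra.
  have := le_trans (sqr_le_sqnorm q i) h3 => h4.
  rewrite ler_norml; have := sqr_ge0 (q i 0 - 1); have := sqr_ge0 (q i 0 + 1).
  by move: h4 (sqr_ge0 (q i 0)); rewrite !expr2 => *; apply/andP; split; lra.
have : sqnorm (res q) <= rho * sqnorm (res q).
  apply: (le_trans (qmin (q + res q) I)).
  have -> : res (q + res q) = D *m relu (q + res q) - D *m relu q.
    by apply/colP => i; rewrite !mxE; ring.
  by apply: (le_trans (Drelu _ _)); rewrite addrAC subrr add0r.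
have r0 := sqnorm_ge0 (res q) => r1.
have /eqP : sqnorm (res q) = 0 by nra.
rewrite sqnorm_eq0 subr_eq0 => /eqP e; exists q.
by rewrite /= -{1}e addrK.
Qed.

(** * Sign of the multiplier term and the dissipation inequality *)

Lemma qform_Jmx {R : realType} {m} (J : 'M[R]_m) (a b : 'cV[R]_m) :
  is_diag_mx J -> (forall i, a i 0 * b i 0 = 0) ->
  qform (Jmx J) (col_mx a b) = 0.
Proof.
move=> /is_diag_mxP dJ ab.
have h (u v : 'cV[R]_m) : (forall i, u i 0 * v i 0 = 0) -> (u^T *m J *m v) 0 0 = 0.
  move=> uv; rewrite mxE big1// => i _; rewrite mxE (bigD1 i)//= big1 ?addr0.
    by rewrite mxE mulrAC uv mul0r.
  by move=> j ji; rewrite dJ ?mulr0.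
rewrite /qform /Jmx tr_col_mx mul_row_block mul_row_col !mulmx0 add0r addr0.
by rewrite mxE !h ?addr0// => i; rewrite mulrC.
Qed.

Lemma qform_nonneg {R : realType} {k} (Q : 'M[R]_k) x :
  nonneg_mx Q -> nonneg_mx x -> 0 <= qform Q x.
Proof.
move=> Q0 x0; rewrite qformE; do 2!apply: sumr_ge0 => ? _.
by rewrite !mulr_ge0.
Qed.

(** [Emx] sends [col_mx q (relu q)] to the negative and positive parts of [q]: nonnegative, so [Q]
    contributes a nonnegative amount, and complementary, so [J] contributes nothing. *)
Lemma PiNN_qform_ge0 {R : realType} {m} (Pi : 'M[R]_(m + m)) (q : 'cV[R]_m) :
  PiNN Pi -> 0 <= qform Pi (col_mx q (relu q)).
Proof.
move=> [J [Q [dJ [_ [Q0 ->]]]]]; rewrite qform_mulmx.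
have -> : Emx R m *m col_mx q (relu q) = col_mx (relu q - q) (relu q).
  by rewrite /Emx mul_block_col mulNmx !mul1mx mul0mx add0r addrC.
rewrite qformD qform_Jmx ?addr0//; last first.
  move=> i; rewrite !mxE; case: leP => _; first by rewrite mulr0.
  by rewrite subrr mul0r.
apply: qform_nonneg => // i j.
case: (split_ordP i) => l ->; rewrite ?col_mxEu ?col_mxEd !mxE (ord1 j).
  by rewrite subr_ge0 le_max lexx.
by rewrite le_max lexx orbT.
Qed.

(** The right side is the derivative of [x^T P x] in the direction [A x + B p]; symmetry of [P]
    identifies the transposed cross terms. *)
Lemma qform_lyapunov {R : realType} {n m} (P A : 'M[R]_n) (B : 'M[R]_(n, m))
    (x : 'cV[R]_n) (p : 'cV[R]_m) : Defs.symmetric P ->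
  qform (block_mx (P *m A + A^T *m P) (P *m B) (B^T *m P) 0) (col_mx x p) =
  2 * (x^T *m P *m (A *m x + B *m p)) 0 0.
Proof.
move=> sP; rewrite /qform tr_col_mx mul_row_block mul_row_col mulmx0 addr0.
set u := A *m x; set v := B *m p.
have tr (w : 'cV[R]_n) : (w^T *m P *m x) 0 0 = (x^T *m P *m w) 0 0.
  suff -> : w^T *m P *m x = (x^T *m P *m w)^T by rewrite mxE.
  by rewrite !trmx_mul trmxK mulmxA sP.
have -> : (x^T *m (P *m A + A^T *m P) + p^T *m (B^T *m P)) *m x +
    x^T *m (P *m B) *m p =
    x^T *m P *m u + u^T *m P *m x + v^T *m P *m x + x^T *m P *m v.
  by rewrite /u /v !trmx_mul !mulmxDl !mulmxDr !mulmxDl !mulmxA.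
have add2 (a b : 'M[R]_1) : (a + b) 0 0 = a 0 0 + b 0 0 by rewrite mxE.
by rewrite mulmxDr !add2 !tr; ring.
Qed.

Lemma primal_dissipation {R : realType} {n m} (A : 'M[R]_n) (B : 'M[R]_(n, m))
    (C : 'M[R]_(m, n)) (D : 'M[R]_m) :
  specnorm D < 1 -> primal_LMI A B C D ->
  exists P, posdef P /\ exists2 c, 0 < c & forall x,
    2 * (x^T *m P *m sysf A B C D x) 0 0 <= - (c * sqnorm x).
Proof.
move=> D1 [P [Pi [pP [PiP /posdef_coercive[c c0 hc]]]]].
exists P; split=> //; exists c => // x.
rewrite /sysf; set q := resolv D (C *m x).
have qE : C *m x + D *m relu q = q by rewrite -[C *m x](resolvP D _ D1) subrK.
have := hc (col_mx x (relu q)).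
rewrite qformN qformD (qform_lyapunov _ _ _ _ _ pP.1) qform_mulmx.
rewrite mul_block_col qE mul0mx add0r mul1mx.
have : sqnorm x <= sqnorm (col_mx x (relu q)).
  rewrite /sqnorm big_split_ord/=.
  under [X in _ <= X + _]eq_bigr do rewrite col_mxEu.
  by rewrite lerDl sumr_ge0// => i _; exact: sqr_ge0.
move=> /(ler_wpM2l (ltW c0)); have := PiNN_qform_ge0 Pi q PiP; lra.
Qed.

(** * Derivatives along trajectories and Lyapunov stability *)

Lemma is_derive_coord {R : realType} {n} (x : R -> 'cV[R]_n) (t : R) dx i :
  is_derive t 1 x dx -> is_derive t 1 (fun s => x s i 0) (dx i 0).
Proof.
move=> [dxt <-]; have d := (derivable_mxP _ _ _).1 dxt i 0.
by apply: DeriveDef => //; rewrite derive_mx// mxE.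
Qed.

Lemma is_derive_qform {R : realType} {n} (P : 'M[R]_n) (x : R -> 'cV[R]_n)
    (t : R) dx : Defs.symmetric P -> is_derive t 1 x dx ->
  is_derive t 1 (fun s => qform P (x s)) (2 * ((x t)^T *m P *m dx) 0 0).
Proof.
move=> sP dxt; pose xi i s := x s i 0.
have dxi i : is_derive t 1 (xi i) (dx i 0) by exact: is_derive_coord.
have -> : (fun s => qform P (x s)) = \sum_i (xi i * \sum_j (P i j \*: xi j)).
  apply/funext => s; rewrite qformE fct_sumE; apply: eq_bigr => i _.
  rewrite [RHS]/GRing.mul/= fct_sumE mulr_sumr; apply: eq_bigr => j _.
  by rewrite -mulrA.
have h i : is_derive t 1 (xi i * \sum_j (P i j \*: xi j))
    (xi i t *: (\sum_j P i j *: dx j 0) + (\sum_j (P i j \*: xi j)) t *: dx i 0).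
  by apply: is_deriveM; apply: is_derive_sum => j; exact: is_deriveZ.
apply: is_derive_eq (is_derive_sum h) _.
have tr : ((x t)^T *m P *m dx) 0 0 = (dx^T *m P *m x t) 0 0.
  suff -> : (x t)^T *m P *m dx = (dx^T *m P *m x t)^T by rewrite mxE.
  by rewrite !trmx_mul trmxK mulmxA sP.
rewrite big_split/= mulr2n mulrDl mul1r {2}tr; congr (_ + _).
  rewrite -mulmxA mxE; apply: eq_bigr => i _; rewrite !mxE.
  by congr (_ * _); apply: eq_bigr => j _.
rewrite -mulmxA mxE; apply: eq_bigr => i _; rewrite !mxE fct_sumE mulrC.
by congr (_ * _); apply: eq_bigr => j _.
Qed.

(* [V' <= - c V] makes [V t * (1 + c t)] nonincreasing, an algebraic decay
   rate that spares the exponential. *)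
Lemma lyapunov_decay {R : realType} (V dV : R -> R) (c : R) : 0 < c ->
  (forall t, 0 <= V t) ->
  (forall t : R, 0 < t -> is_derive t 1 V (dV t)) ->
  (forall t : R, 0 < t -> dV t <= - (c * V t)) ->
  V t @[t --> 0^'+] --> V 0 ->
  forall t : R, 0 <= t -> V t * (1 + c * t) <= V 0.
Proof.
move=> c0 V0 dVt hV cV t t0.
pose g : R -> R := cst 1 + c \*: id.
have gE s : g s = 1 + c * s by [].
have dg (s : R) : is_derive s 1 g (0 + c *: 1) by exact: is_deriveD.
have dW (s : R) : 0 < s -> is_derive s 1 (V * g) (V s *: (0 + c *: 1) + g s *: dV s).
  by move=> /dVt s0; exact: is_deriveM.
have cg : continuous g.
  move=> s; have [dgs _] := dg s.
  exact/differentiable_continuous/derivable1_diffP.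
suff : (V * g) t <= (V * g) 0.
  by rewrite /GRing.mul/= !gE mulr0 addr0 mulr1.
apply: (@ler0_derive1_nincry _ (V * g) 0) => //.
- by move=> s; rewrite in_itv/= andbT => /dW[].
- move=> s; rewrite in_itv/= andbT => s0; have [_ e] := dW s s0.
  rewrite derive1E e add0r gE /GRing.scale/= mulr1.
  have h : 0 < 1 + c * s by rewrite addr_gt0// mulr_gt0.
  have := ler_wpM2l (ltW h) (hV s s0).
  (* The derivative of [V * g] is at most [c * V s - (1 + c * s) * (c * V s)], the negative of this
     quantity. *)
  have : 0 <= c * s * (c * V s) by rewrite !mulr_ge0 ?V0// ltW.
  lra.
- apply/continuous_within_itvcyP; split=> [s|].
    rewrite in_itv/= andbT => /dW[d _].
    exact/differentiable_continuous/derivable1_diffP.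
  apply: cvgM => //; apply: cvg_at_right_filter; exact: cg.
Qed.

(** Comparing the form [V] with the squared norm from both sides turns the hypothesis into
    [V' <= - (c / c2) * V]; the decay of [V] then gives stability and convergence together. *)
Lemma lyapunov_GAS {R : realType} {n} (f : 'cV[R]_n -> 'cV[R]_n) (P : 'M[R]_n)
    (c : R) : posdef P -> 0 < c ->
  (forall x, 2 * (x^T *m P *m f x) 0 0 <= - (c * sqnorm x)) -> GAS f.
Proof.
move=> pP c0 hf.
have [c1 c10 hc1] := posdef_coercive P pP.
have [c2 c20 hc2] := qform_bounded P.
have hc2' x : qform P x <= c2 * sqnorm x := le_trans (ler_norm _) (hc2 x).
have cc : 0 < c / c2 by rewrite divr_gt0.
have main x : is_solution f x -> forall t, 0 <= t ->
    c1 * sqnorm (x t) * (1 + c / c2 * t) <= c2 * sqnorm (x 0).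
  move=> [dx cx] t t0.
  have p1 : 0 <= 1 + c / c2 * t by rewrite addr_ge0// mulr_ge0// ltW.
  apply: (le_trans (ler_wpM2r p1 (hc1 (x t)))).
  apply: (le_trans _ (hc2' (x 0))).
  apply: (@lyapunov_decay _ (fun t => qform P (x t))
    (fun t => 2 * ((x t)^T *m P *m f (x t)) 0 0)) => //.
  - by move=> s; apply: (le_trans _ (hc1 _)); rewrite mulr_ge0 ?sqnorm_ge0// ltW.
  - by move=> s s0; apply: is_derive_qform; [exact: pP.1|exact: dx].
  - move=> s s0; apply: (le_trans (hf _)); rewrite lerN2 mulrAC -mulrA.
    by rewrite ler_pM2l// ler_pdivrMr// mulrC.
  - rewrite qformE; under eq_fun do rewrite qformE.
    have cxi i : x t i 0 @[t --> 0^'+] --> x 0 i 0.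
      exact: (cvg_comp _ _ cx (@coord_continuous _ _ _ i 0 (x 0))).
    apply: cvg_sum_ord => i; apply: cvg_sum_ord => j.
    by apply: cvgM => //; apply: cvgM => //; exact: cvg_cst.
split=> [eps eps0|x sx].
  (* Since [sqnorm (x t) <= k * sqnorm (x 0)] and [k >= 1], the choice [delta = eps / k] leads to
     [eps ^+ 2 / k <= eps ^+ 2]. *)
  pose k := c2 / c1 + 1.
  have k1 : 1 <= k by rewrite lerDr divr_ge0 ?ltW.
  have k0 : 0 < k by rewrite (lt_le_trans _ k1).
  exists (eps / k); first by rewrite divr_gt0.
  move=> x sx; rewrite !enorm_lt ?divr_gt0// => x0 t t0; rewrite enorm_lt//.
  have p1 : 1 <= 1 + c / c2 * t by rewrite lerDl mulr_ge0// ltW.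
  have : sqnorm (x t) <= k * sqnorm (x 0).
    have : c1 * sqnorm (x t) <= c2 * sqnorm (x 0).
      apply: (le_trans _ (main x sx t t0)); rewrite ler_peMr//.
      by rewrite mulr_ge0 ?sqnorm_ge0// ltW.
    rewrite -ler_pdivlMl// => h; apply: (le_trans h).
    rewrite mulrA ler_wpM2r ?sqnorm_ge0// mulrC /k; lra.
  move=> /le_lt_trans; apply.
  rewrite mulrC -ltr_pdivlMr//; apply: (lt_le_trans x0).
  rewrite expr_div_n ler_wpM2l ?sqr_ge0// lef_pV2 ?posrE ?exprn_gt0//.
  by rewrite expr2 ler_peMr// ltW.
apply/cvgrPdist_lt => eps eps0.
near=> t.
have t0 : 0 <= t by near: t; apply: nbhs_pinfty_ge; exact: num_real.
rewrite sub0r normrN ger0_norm ?enorm_ge0// enorm_lt//.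
have e0 : 0 < c1 * eps ^+ 2 by rewrite mulr_gt0// exprn_gt0.
(* Past this time the decay bound forces [sqnorm (x t)] below [eps ^+ 2]. *)
have tb : c2 * sqnorm (x 0) / (c1 * eps ^+ 2) / (c / c2) < t.
  by near: t; apply: nbhs_pinfty_gt; exact: num_real.
have p0 : 0 < 1 + c / c2 * t by rewrite ltr_pwDl// mulr_ge0// ltW.
rewrite -(ltr_pM2l c10) -(ltr_pM2r p0); apply: (le_lt_trans (main x sx t t0)).
move: tb; rewrite ltr_pdivrMr// ltr_pdivrMr//.
lra.
Unshelve. all: by end_near. Qed.

(** * Linearity of the LMI and the convex cone of multipliers *)

Definition LMI {R : realType} {n m} (A : 'M[R]_n) (B : 'M[R]_(n, m))
    (C : 'M[R]_(m, n)) (D : 'M[R]_m) (P : 'M[R]_n) (Pi : 'M[R]_(m + m)) :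
    'M[R]_(n + m) :=
  block_mx (P *m A + A^T *m P) (P *m B) (B^T *m P) 0
  + (block_mx C D 0 1%:M)^T *m Pi *m block_mx C D 0 1%:M.

Lemma LMID {R : realType} {n m} (A : 'M[R]_n) (B : 'M[R]_(n, m))
    (C : 'M[R]_(m, n)) (D : 'M[R]_m) P P' Pi Pi' :
  LMI A B C D (P + P') (Pi + Pi') = LMI A B C D P Pi + LMI A B C D P' Pi'.
Proof.
rewrite /LMI [RHS]addrACA -mulmxDl -mulmxDr; congr (_ + _).
by rewrite add_block_mx addr0 !mulmxDl !mulmxDr addrACA.
Qed.

Lemma LMIZ {R : realType} {n m} (A : 'M[R]_n) (B : 'M[R]_(n, m))
    (C : 'M[R]_(m, n)) (D : 'M[R]_m) a P Pi :
  LMI A B C D (a *: P) (a *: Pi) = a *: LMI A B C D P Pi.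
Proof.
rewrite /LMI scalerDr scale_block_mx scaler0 scalerDr.
by rewrite -!scalemxAl -!scalemxAr -!scalemxAl.
Qed.

Lemma LMI00 {R : realType} {n m} (A : 'M[R]_n) (B : 'M[R]_(n, m))
    (C : 'M[R]_(m, n)) (D : 'M[R]_m) : LMI A B C D 0 0 = 0.
Proof. by have := LMIZ A B C D 0 0 0; rewrite !scale0r. Qed.

Lemma LMI_symmetric {R : realType} {n m} (A : 'M[R]_n) (B : 'M[R]_(n, m))
    (C : 'M[R]_(m, n)) (D : 'M[R]_m) P Pi :
  Defs.symmetric P -> Defs.symmetric Pi -> Defs.symmetric (LMI A B C D P Pi).
Proof.
move=> sP sPi; rewrite /Defs.symmetric /LMI linearD/= !trmx_mul trmxK sPi mulmxA.
congr (_ + _); rewrite tr_block_mx trmx0 linearD/= !trmx_mul !trmxK sP.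
by rewrite addrC.
Qed.

Lemma PiNN_symmetric {R : realType} {m} (Pi : 'M[R]_(m + m)) :
  PiNN Pi -> Defs.symmetric Pi.
Proof.
move=> [J [Q [/is_diag_mxP dJ [sQ [_ ->]]]]].
have tJ : J^T = J.
  apply/matrixP => i j; rewrite mxE; have [->//|ij] := eqVneq i j.
  by rewrite !dJ// eq_sym.
rewrite /Defs.symmetric !trmx_mul trmxK mulmxA; congr (_ *m _ *m _).
by rewrite linearD/= sQ /Jmx tr_block_mx !trmx0 tJ.
Qed.

Lemma JmxD {R : realType} {m} (J J' : 'M[R]_m) : Jmx (J + J') = Jmx J + Jmx J'.
Proof. by rewrite /Jmx add_block_mx !addr0. Qed.

Lemma JmxZ {R : realType} {m} a (J : 'M[R]_m) : Jmx (a *: J) = a *: Jmx J.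
Proof. by rewrite /Jmx scale_block_mx !scaler0. Qed.

Lemma PiNN_intro {R : realType} {m} (J : 'M[R]_m) (Q : 'M[R]_(m + m)) :
  is_diag_mx J -> Defs.symmetric Q -> nonneg_mx Q ->
  PiNN ((Emx R m)^T *m (Q + Jmx J) *m Emx R m).
Proof. by move=> *; exists J, Q. Qed.

Lemma PiNN_D {R : realType} {m} (Pi Pi' : 'M[R]_(m + m)) :
  PiNN Pi -> PiNN Pi' -> PiNN (Pi + Pi').
Proof.
move=> [J [Q [/is_diag_mxP dJ [sQ [Q0 ->]]]]].
move=> [J' [Q' [/is_diag_mxP dJ' [sQ' [Q0' ->]]]]].
rewrite -mulmxDl -mulmxDr addrACA -JmxD; apply: PiNN_intro.
- by apply/is_diag_mxP => i j ij; rewrite mxE dJ ?dJ' ?addr0.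
- by rewrite /Defs.symmetric linearD/= sQ sQ'.
- by move=> i j; rewrite mxE addr_ge0.
Qed.

Lemma PiNN_Z {R : realType} {m} a (Pi : 'M[R]_(m + m)) :
  0 <= a -> PiNN Pi -> PiNN (a *: Pi).
Proof.
move=> a0 [J [Q [/is_diag_mxP dJ [sQ [Q0 ->]]]]].
rewrite scalemxAl scalemxAr scalerDr -JmxZ; apply: PiNN_intro.
- by apply/is_diag_mxP => i j ij; rewrite mxE dJ ?mulr0.
- by rewrite /Defs.symmetric linearZ/= sQ.
- by move=> i j; rewrite mxE mulr_ge0.
Qed.

Lemma PiNN_0 {R : realType} {m} : PiNN (0 : 'M[R]_(m + m)).
Proof.
have J0 : Jmx (0 : 'M[R]_m) = 0 by rewrite -(scale0r 0) JmxZ scale0r.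
have := @PiNN_intro R m 0 0; rewrite J0 addr0 mulmx0 mul0mx.
apply; first by apply/is_diag_mxP => i j _; rewrite mxE.
- by rewrite /Defs.symmetric trmx0.
- by move=> i j; rewrite mxE.
Qed.

Lemma possemidef0 {R : realType} {k} : possemidef (0 : 'M[R]_k).
Proof.
by split=> [|x]; rewrite ?mulmx0 ?mul0mx ?mxE// /Defs.symmetric trmx0.
Qed.

Lemma possemidefD {R : realType} {k} (M N : 'M[R]_k) :
  possemidef M -> possemidef N -> possemidef (M + N).
Proof.
move=> [sM pM] [sN pN]; split; first by rewrite /Defs.symmetric linearD/= sM sN.
by move=> x; rewrite -/(qform _ x) qformD; apply: addr_ge0; [exact: pM|exact: pN].
Qed.

Lemma possemidefZ {R : realType} {k} a (M : 'M[R]_k) :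
  0 <= a -> possemidef M -> possemidef (a *: M).
Proof.
move=> a0 [sM pM]; split; first by rewrite /Defs.symmetric linearZ/= sM.
by move=> x; rewrite -/(qform _ x) qformZ; apply: mulr_ge0 => //; exact: pM.
Qed.

(** * Dual operators, trace identities and weak duality *)

Definition dualF {R : realType} {n m} (C : 'M[R]_(m, n)) (D : 'M[R]_m) :
  'M[R]_(m + m, n + m) := block_mx (- C) (1%:M - D) 0 1%:M.

Definition dualX {R : realType} {n m} (A : 'M[R]_n) (B : 'M[R]_(n, m))
    (H : 'M[R]_(n + m)) : 'M[R]_n :=
  A *m ulsubmx H + B *m (ursubmx H)^T + (A *m ulsubmx H + B *m (ursubmx H)^T)^T.

Lemma symmetric_block {R : realType} {n m} (H : 'M[R]_(n + m)) :
  Defs.symmetric H ->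
  H = block_mx (ulsubmx H) (ursubmx H) (ursubmx H)^T (drsubmx H).
Proof. by move=> sH; rewrite trmx_ursub sH submxK. Qed.

(* The operators of the dual LMI are the adjoints of those of the primal LMI. *)
Lemma LMI_adjoint {R : realType} {n m} (A : 'M[R]_n) (B : 'M[R]_(n, m))
    (C : 'M[R]_(m, n)) (D : 'M[R]_m) P S (H : 'M[R]_(n + m)) :
  Defs.symmetric H ->
  \tr (LMI A B C D P ((Emx R m)^T *m S *m Emx R m) *m H) =
  \tr (P *m dualX A B H) + \tr (S *m (dualF C D *m H *m (dualF C D)^T)).
Proof.
move=> sH; rewrite /LMI mulmxDl mxtraceD; congr (_ + _).
  have s11 : (ulsubmx H)^T = ulsubmx H by rewrite trmx_ulsub sH.
  rewrite {1}(symmetric_block H sH) mulmx_block mxtrace_block mul0mx addr0.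
  rewrite /dualX [(_ + _)^T]linearD/= !trmx_mul trmxK s11 !mulmxDr !mulmxDl !mxtraceD.
  rewrite !mulmxA [\tr (P *m ulsubmx H *m A^T)]mxtrace_mulC.
  by rewrite [\tr (P *m ursubmx H *m B^T)]mxtrace_mulC !mulmxA; ring.
(* [dualF] is the product of [Emx] with the outer factor of the LMI, so cyclicity of the trace moves
   both congruences onto [H]. *)
have EF : Emx R m *m block_mx C D 0 1%:M = dualF C D.
  rewrite /Emx mulmx_block !mulNmx !mul1mx !mul0mx ?addr0 ?add0r.
  by rewrite addrC.
rewrite -EF trmx_mul !mulmxA; set N := block_mx C D 0 1%:M.
rewrite -mulmxA -mulmxA -mulmxA -mulmxA mxtrace_mulC !mulmxA.
by rewrite [RHS]mxtrace_mulC !mulmxA.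
Qed.

Lemma mxtrace_mulE {R : realType} {k} (X Y : 'M[R]_k) :
  \tr (X *m Y) = \sum_i \sum_j X i j * Y j i.
Proof. by apply: eq_bigr => i _; rewrite mxE. Qed.

Lemma mxdot_trace {R : realType} {k} (H X : 'M[R]_k) : Defs.symmetric H ->
  mxdot H X = \tr (X *m H).
Proof.
move=> sH; rewrite mxtrace_mulE; do 2!apply: eq_bigr => ? _.
by rewrite -{1}sH mxE mulrC.
Qed.

Lemma mxtrace_delta_mul {R : realType} {k} (G : 'M[R]_k) i j :
  \tr (delta_mx i j *m G) = G j i.
Proof.
rewrite -(mul_delta_mx (0 : 'I_1)) -mulmxA mxtrace_mulC trace_mx11 -rowE -colE.
by rewrite !mxE.
Qed.

(** As [J] is diagonal, the pairing sees only the diagonal of the off-diagonal block of [G]; this is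
    the source of the zero-diagonal condition in the dual LMI. *)
Lemma mxtrace_Jmx {R : realType} {m} (J : 'M[R]_m) (G : 'M[R]_(m + m)) :
  is_diag_mx J -> Defs.symmetric G ->
  \tr (Jmx J *m G) = 2 * \sum_i J i i * ursubmx G i i.
Proof.
move=> /is_diag_mxP dJ sG; rewrite {1}(symmetric_block G sG) /Jmx mulmx_block.
rewrite mxtrace_block !mul0mx add0r addr0.
have h (M : 'M[R]_m) : \tr (J *m M) = \sum_i J i i * M i i.
  apply: eq_bigr => i _; rewrite mxE (bigD1 i)//= big1 ?addr0// => j ji.
  by rewrite dJ ?mul0r// eq_sym.
rewrite !h mulrDl mul1r; congr (_ + _).
by apply: eq_bigr => i _; congr (_ * _); rewrite mxE.
Qed.

Lemma ursubmx_dualF {R : realType} {n m} (C : 'M[R]_(m, n)) (D : 'M[R]_m)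
    (H : 'M[R]_(n + m)) : Defs.symmetric H ->
  ursubmx (dualF C D *m H *m (dualF C D)^T) =
  - C *m ursubmx H + (1%:M - D) *m drsubmx H.
Proof.
move=> sH; rewrite {1}(symmetric_block H sH) /dualF tr_block_mx !mulmx_block.
by rewrite block_mxKur trmx0 trmx1 mulmx0 add0r mulmx1.
Qed.

Lemma congr_symmetric {R : realType} {p k} (F : 'M[R]_(p, k)) (H : 'M[R]_k) :
  Defs.symmetric H -> Defs.symmetric (F *m H *m F^T).
Proof. by move=> sH; rewrite /Defs.symmetric !trmx_mul trmxK mulmxA sH. Qed.

(** The trace of the LMI matrix against [H] is negative by definiteness; by adjointness it is the
    sum of nonnegative pairings with [P] and [Q] and a vanishing one with [J]. *)
Lemma dual_not_primal {R : realType} {n m} (A : 'M[R]_n) (B : 'M[R]_(n, m))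
    (C : 'M[R]_(m, n)) (D : 'M[R]_m) :
  dual_LMI A B C D -> ~ primal_LMI A B C D.
Proof.
move=> [H [H0 [pH [pX [G0 d0]]]]] [P [Pi [pP [[J [Q [dJ [sQ [Q0 ->]]]]] nL]]]].
have := mxtrace_posdef_gt0 _ H nL pH H0; rewrite mulNmx linearN/= oppr_gt0.
rewrite -/(LMI A B C D P _) (LMI_adjoint _ _ _ _ _ _ _ pH.1) mulmxDl mxtraceD.
rewrite (mxtrace_Jmx _ _ dJ (congr_symmetric _ _ pH.1)).
rewrite (ursubmx_dualF _ _ _ pH.1) big1 ?mulr0 ?addr0 => [|i _]; last first.
  by rewrite d0 mulr0.
apply/negP; rewrite -leNgt addr_ge0//.
  apply: mxtrace_possemidef_ge0 => //; split=> [|x]; first exact: pP.1.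
  by have [->|/pP.2/ltW//] := eqVneq x 0; rewrite mulmx0 mxE.
rewrite mxtrace_mulE; do 2!apply: sumr_ge0 => ? _.
by apply: mulr_ge0; [exact: Q0|exact: G0].
Qed.

(** * From infeasibility of the primal LMI to a dual solution *)

Lemma possemidef_perturb_primal {R : realType} {n m} (A : 'M[R]_n)
    (B : 'M[R]_(n, m)) (C : 'M[R]_(m, n)) (D : 'M[R]_m) P Pi (c : R) :
  possemidef P -> PiNN Pi -> 0 < c ->
  (forall x, qform (LMI A B C D P Pi) x <= - (c * sqnorm x)) ->
  primal_LMI A B C D.
Proof.
move=> [sP pP] PiP c0 hL.
have [b b0 hb] := qform_bounded (LMI A B C D 1%:M 0).
(* With this [e], adding [e *: 1%:M] to [P] uses at most half of the margin [c]. *)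
pose e := c / (2 * b); have e0 : 0 < e by rewrite divr_gt0// mulr_gt0.
have sP' : Defs.symmetric (P + e *: 1%:M).
  by rewrite /Defs.symmetric linearD/= linearZ/= trmx1 sP.
have LE : LMI A B C D (P + e *: 1%:M) Pi =
    LMI A B C D P Pi + e *: LMI A B C D 1%:M 0.
  by rewrite -LMIZ scaler0 -LMID addr0.
exists (P + e *: 1%:M), Pi; split; last split=> //.
  split=> // x x0; rewrite -/(qform _ x) qformD qformZ qform1.
  by apply: ltr_wpDl; [exact: pP|rewrite mulr_gt0 ?sqnorm_gt0].
rewrite -/(LMI A B C D _ Pi); split.
  have := LMI_symmetric A B C D _ Pi sP' (PiNN_symmetric _ PiP).
  by rewrite /Defs.symmetric linearN/= => ->.
move=> x x0; rewrite -/(qform _ x) qformN oppr_gt0 LE qformD qformZ.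
have h : e * qform (LMI A B C D 1%:M 0) x <= c / 2 * sqnorm x.
  have -> : c / 2 * sqnorm x = e * (b * sqnorm x).
    by rewrite /e; field; rewrite gt_eqF.
  by rewrite ler_pM2l//; exact: le_trans (ler_norm _) (hb x).
have : 0 < c * sqnorm x by rewrite mulr_gt0 ?sqnorm_gt0.
have := hL x; lra.
Qed.

(** The semidefinite slack makes [- 1%:M] a member exactly when some value of the LMI is at most
    [- 1%:M] in the semidefinite order. *)
Definition primal_cone {R : realType} {n m} (A : 'M[R]_n) (B : 'M[R]_(n, m))
    (C : 'M[R]_(m, n)) (D : 'M[R]_m) : set 'M[R]_(n + m) :=
  [set X | exists P Pi,
    [/\ possemidef P, PiNN Pi & possemidef (X - LMI A B C D P Pi)]].

Lemma primal_cone_LMI {R : realType} {n m} (A : 'M[R]_n) (B : 'M[R]_(n, m))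
    (C : 'M[R]_(m, n)) (D : 'M[R]_m) P Pi :
  possemidef P -> PiNN Pi -> primal_cone A B C D (LMI A B C D P Pi).
Proof.
by move=> pP PiP; exists P, Pi; split=> //; rewrite subrr; exact: possemidef0.
Qed.

Lemma primal_cone_possemidef {R : realType} {n m} (A : 'M[R]_n)
    (B : 'M[R]_(n, m)) (C : 'M[R]_(m, n)) (D : 'M[R]_m) X :
  possemidef X -> primal_cone A B C D X.
Proof.
move=> pX; exists 0, 0; rewrite LMI00 subr0.
by split=> //; [exact: possemidef0|exact: PiNN_0].
Qed.

(** Equality of two mirrored entries is a closed condition, so it passes from the cone to its
    closure. *)
Lemma primal_cone_symmetric {R : realType} {n m} (A : 'M[R]_n)
    (B : 'M[R]_(n, m)) (C : 'M[R]_(m, n)) (D : 'M[R]_m) X :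
  closure (primal_cone A B C D) X -> Defs.symmetric X.
Proof.
move=> KX; apply/matrixP => i j; rewrite mxE; apply/eqP; rewrite -subr_eq0.
apply/eqP; pose S := [set Y : 'M[R]_(n + m) | Y j i - Y i j = 0].
have cS : closed S.
  apply: ((continuous_closedP (fun Y : 'M[R]_(n + m) => Y j i - Y i j)).1 _ _
    (@closed_eq _ 0)).
  by apply: continuous_subr; exact: coord_continuous.
apply: cS; apply: closure_subset KX => Y [P [Pi [[sP _] PiP [sY _]]]].
have sY' : Y^T = Y.
  rewrite -[Y in Y^T](subrK (LMI A B C D P Pi)) linearD/= sY.
  by rewrite (LMI_symmetric A B C D _ _ sP (PiNN_symmetric _ PiP)) subrK.
by rewrite /S /= -{2}sY' mxE subrr.
Qed.

(** A member of the cone near [- 1%:M] has form at most [- sqnorm x / 2], and so has the LMI value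
    below it; this margin allows [P] to be perturbed into a primal solution. *)
Lemma neg1_notin_closure_primal_cone {R : realType} {n m} (A : 'M[R]_n)
    (B : 'M[R]_(n, m)) (C : 'M[R]_(m, n)) (D : 'M[R]_m) :
  ~ primal_LMI A B C D -> ~ closure (primal_cone A B C D) (- 1%:M).
Proof.
move=> nP K1; apply: nP.
(* Entries within [e] change the form by at most [e * (n + m) * sqnorm x <= sqnorm x / 2]; the
   successor keeps the denominator nonzero when [n + m = 0]. *)
pose e : R := (2 * (n + m).+1%:R)^-1.
have e0 : 0 < e by rewrite invr_gt0 mulr_gt0.
have [X [[P [Pi [pP PiP [_ pX]]]] [_ Xe]]] := K1 _ (nbhsx_ballx _ _ e0).
apply: (possemidef_perturb_primal A B C D P Pi 2^-1) => //.
  by rewrite invr_gt0.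
move=> x.
have : qform (LMI A B C D P Pi) x <= qform X x.
  by rewrite -subr_ge0 -qformB; exact: pX.
move=> /le_trans; apply.
have -> : qform X x = qform (X + 1%:M) x - sqnorm x.
  by rewrite qformD qform1 addrK.
have : `|qform (X + 1%:M) x| <= e * (n + m)%:R * sqnorm x.
  apply: norm_qform_le => i j; have := Xe i j.
  by rewrite /ball/= !mxE -opprD normrN addrC => /ltW.
have ek : e * (n + m)%:R <= 2^-1.
  rewrite /e invfM -mulrA ler_piMr ?invr_ge0// mulrC ler_pdivrMr// mul1r.
  by rewrite ler_nat.
have := ler_wpM2r (sqnorm_ge0 x) ek.
have := ler_norm (qform (X + 1%:M) x); lra.
Qed.

Lemma not_primal_dual {R : realType} {n m} (A : 'M[R]_n) (B : 'M[R]_(n, m))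
    (C : 'M[R]_(m, n)) (D : 'M[R]_m) :
  ~ primal_LMI A B C D -> dual_LMI A B C D.
Proof.
move=> nP.
have [||||H [H0 KH Hdot]] := cone_separation (primal_cone A B C D) (- 1%:M).
- exact/primal_cone_possemidef/possemidef0.
- move=> X Y [P [Pi [pP PiP pX]]] [P' [Pi' [pP' PiP' pY]]].
  exists (P + P'), (Pi + Pi'); split; [exact: possemidefD|exact: PiNN_D|].
  by rewrite LMID opprD addrACA; exact: possemidefD.
- move=> t X t0 [P [Pi [pP PiP pX]]].
  exists (t *: P), (t *: Pi); split; [exact: possemidefZ|exact: PiNN_Z|].
  by rewrite LMIZ -scalerBr; exact: possemidefZ.
- exact: neg1_notin_closure_primal_cone.
(* The closure contains [- 1%:M + H], so this sum is symmetric, as is [- 1%:M]. *)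
have sH : Defs.symmetric H.
  have := primal_cone_symmetric _ _ _ _ _ KH; rewrite /Defs.symmetric.
  by rewrite linearD/= linearN/= trmx1 => /addrI.
(* Separation is carried to the dual side; the last three dual conditions follow by letting one of
   [P], [Q], [J] be nonzero at a time. *)
have Htr P J Q : possemidef P -> is_diag_mx J -> Defs.symmetric Q ->
    nonneg_mx Q -> 0 <= \tr (P *m dualX A B H) +
      \tr ((Q + Jmx J) *m (dualF C D *m H *m (dualF C D)^T)).
  move=> pP dJ sQ Q0; rewrite -LMI_adjoint// -mxdot_trace//.
  by apply/Hdot/primal_cone_LMI => //; exact: PiNN_intro.
set G := dualF C D *m H *m (dualF C D)^T in Htr.
have sG : Defs.symmetric G by exact: congr_symmetric.
have d0 : is_diag_mx (0 : 'M[R]_m) by apply/is_diag_mxP => i j _; rewrite mxE.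
have s0 : Defs.symmetric (0 : 'M[R]_(m + m)) by rewrite /Defs.symmetric trmx0.
have n0 : nonneg_mx (0 : 'M[R]_(m + m)) by move=> i j; rewrite mxE.
have trJ0 : \tr (Jmx 0 *m G) = 0.
  by rewrite mxtrace_Jmx// big1 ?mulr0// => i _; rewrite mxE mul0r.
exists H; split=> //; split.
  split=> // x; rewrite -/(qform H x) qform_trace mxtrace_mulC -mxdot_trace//.
  exact/Hdot/primal_cone_possemidef/outer_possemidef.
split; [|split].
- split=> [|x]; first by rewrite /Defs.symmetric linearD/= trmxK addrC.
  have := Htr _ _ _ (outer_possemidef x) d0 s0 n0.
  by rewrite add0r trJ0 addr0 mxtrace_mulC -qform_trace.
- move=> i j; rewrite -/(dualF C D) -/G.
  (* [Q] must be symmetric, hence the symmetrised unit matrix, which yields twice [G i j]. *)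
  have := Htr 0 0 (delta_mx i j + delta_mx j i) possemidef0 d0.
  rewrite mul0mx mxtrace0 add0r mulmxDl mxtraceD trJ0 addr0 mulmxDl mxtraceD.
  rewrite !mxtrace_delta_mul -{1}sG mxE.
  have sQ : Defs.symmetric (delta_mx i j + delta_mx j i : 'M[R]_(m + m)).
    by rewrite /Defs.symmetric linearD/= !trmx_delta addrC.
  have Q0 : nonneg_mx (delta_mx i j + delta_mx j i : 'M[R]_(m + m)).
    by move=> k l; rewrite !mxE addr_ge0// ler0n.
  by move=> /(_ sQ Q0); lra.
- move=> i; rewrite -ursubmx_dualF// -/G.
  (* The diagonal of [J] may have either sign, so [a = 1] and [a = - 1] together force equality. *)
  have h a : 0 <= 2 * (a * ursubmx G i i).
    have dJ : is_diag_mx (a *: delta_mx i i : 'M[R]_m).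
      apply/is_diag_mxP => k l kl; rewrite !mxE.
      case: eqP => [ki|]; last by rewrite mulr0.
      by case: eqP => [li|]; rewrite ?mulr0//; rewrite ki li eqxx in kl.
    have := Htr 0 _ _ possemidef0 dJ s0 n0.
    rewrite mul0mx mxtrace0 !add0r mxtrace_Jmx// (bigD1 i)//= big1 => [|l li].
      by rewrite !mxE !eqxx mulr1 addr0.
    by rewrite !mxE (negbTE li) mulr0 mul0r.
  have := h 1; have := h (- 1); lra.
Qed.

Theorem theorem2 (R : realType) (n m : nat) (A : 'M[R]_n) (B : 'M[R]_(n, m))
  (C : 'M[R]_(m, n)) (D : 'M[R]_m) :
  hurwitz A -> specnorm D < 1 ->
  (primal_LMI A B C D -> GAS (sysf A B C D)) /\
  (~ primal_LMI A B C D <-> dual_LMI A B C D).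
Proof.
move=> _ D1; split=> [/(primal_dissipation A B C D D1)[P [pP [c c0 hP]]]|].
  exact: lyapunov_GAS pP c0 hP.
by split; [exact: not_primal_dual|exact: dual_not_primal].
Qed.
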